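(* Let $n,m\ge1$ be integers, $\ell_{\max}=\lfloor nm/2\rfloor$, and let $\ell$ be an integer with $0<\ell\le\ell_{\max}$. Let $Z_{\ell,m,n}=\{z\in\mathbb{Z}^n: 0\le z_i\le m \text{ for all } i,\ z_1+\cdots+z_n=\ell\}$. Then $$\operatorname{gr}I(Z_{\ell,m,n})=\big\langle x_1^{m+1},\dots,x_n^{m+1},\ x_1+\cdots+x_n,\ x_1^{a_1}\cdots x_n^{a_n}\ \text{ for all } (a_1,\dots,a_n)\in\mathbb{Z}_{\ge0}^n \text{ with } a_1+\cdots+a_n=\ell+1\big\rangle$$ as ideals of $\mathbb{Q}[x_1,\dots,x_n]$.
   Context: For a nonzero polynomial $f\in S=\mathbb{Q}[x_1,\dots,x_n]$, $\tau(f)$ denotes its top-degree homogeneous component (standard grading). For a finite set $Z\subset\mathbb{R}^n$, $I(Z)=\{f\in S: f(z)=0\text{ for all }z\in Z\}$ and the orbit harmonics ideal is $\operatorname{gr}I(Z)=\langle\tau(f): 0\neq f\in I(Z)\rangle$. *)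

(* Defs.v *)
From HB Require Import structures.
From mathcomp Require Export all_boot all_order all_algebra.
From mathcomp Require Export reals.
From mathcomp Require Export mpoly.

Set Implicit Arguments.
Unset Strict Implicit.
Unset Printing Implicit Defensive.

Import Order.TTheory GRing.Theory Num.Theory.
Local Open Scope ring_scope.

(* Subsets of a type are Prop-valued predicates: ideals of Q[x_1, ..., x_n]
   need not come with a decision procedure. *)

Definition ideal_gen (S : comNzRingType) (G : S -> Prop) (f : S) : Prop :=
  exists2 s : seq (S * S),
    (forall hg, hg \in s -> G hg.2) & f = \sum_(hg <- s) hg.1 * hg.2.

Definition same_set (T : Type) (A B : T -> Prop) : Prop :=
  forall x, A x <-> B x.

(* [msize f] is 1 + the total degree of f when f != 0, and [pihomog mdeg d] is
   the projection onto the homogeneous component of degree d. *)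
Definition top_comp (n : nat) (f : {mpoly rat[n]}) : {mpoly rat[n]} :=
  pihomog mdeg (msize f).-1 f.

(* The points are real while the coefficients are rational, hence the
   embedding [ratr] of the coefficients before evaluation. *)
Definition vanishing_ideal (R : realType) (n : nat)
    (Z : ('I_n -> R) -> Prop) (f : {mpoly rat[n]}) : Prop :=
  forall z, Z z -> (map_mpoly (ratr : rat -> R) f).@[z] = 0.

Definition gr_ideal (R : realType) (n : nat)
    (Z : ('I_n -> R) -> Prop) : {mpoly rat[n]} -> Prop :=
  ideal_gen (fun g : {mpoly rat[n]} =>
    exists f : {mpoly rat[n]},
      [/\ f <> 0, vanishing_ideal Z f & g = top_comp f]).

Definition slice (R : realType) (l m n : nat) (z : 'I_n -> R) : Prop :=
  exists a : 'I_n -> int,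
    [/\ forall i, 0 <= a i <= m%:Z,
        \sum_(i < n) a i = l%:Z
      & forall i, z i = (a i)%:~R].

Variant slice_gens (l m n : nat) : {mpoly rat[n]} -> Prop :=
  | GenPower (i : 'I_n) : slice_gens l m ('X_i ^+ m.+1)
  | GenSum : slice_gens l m (\sum_(i < n) 'X_i)
  | GenMonomial (a : 'X_{1..n}) of mdeg a = l.+1 : slice_gens l m 'X_[a].

(* Main.v *)
(** Let [J] be the ideal on the right.  Each generator of [J] is the top
    component of a product of falling factorials, or of [\sum_i 'X_i - l], and
    these vanish on the slice.  Conversely, let [f] of degree [d] vanish on the
    slice.  If [d > l] then its top component is in [J] for degree reasons.  If
    [d <= l], then on the slice [f] agrees with a combination
    [\sum_(|a| = d) h_a (x)_a] of falling factorials, where [h] is the top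
    component of [f] modulo [\sum_i 'X_i].  The values of such a combination on
    consecutive levels of the box [{0..m}^n] are related by the raising operator
    of an sl2-representation, which is injective below the middle level; so the
    combination also vanishes on the level [d] of the box, where its values are
    the [h_a] up to factorials.  Hence [h] is in [J], and so is the top component
    of [f]. *)
From mathcomp Require Import ring.
Require Import Defs.

Set Implicit Arguments.
Unset Strict Implicit.
Unset Printing Implicit Defensive.

Import Order.TTheory GRing.Theory Num.Theory.
Local Open Scope ring_scope.

(** * Levels of multi-indices and the operators [raise] and [lower] *)

Definition level (n j : nat) : seq 'X_{1..n} :=
  [seq s2m t | t : j.-tuple 'I_n <- enum (basis n j)].

Lemma mem_level n j (z : 'X_{1..n}) : (z \in level n j) = (mdeg z == j).
Proof. by rewrite basis_cover. Qed.

Lemma level_uniq n j : uniq (level n j).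
Proof. exact: uniq_basis. Qed.

Lemma big_level_shift (V : nmodType) n (i : 'I_n) j (G : 'X_{1..n} -> V) :
  \sum_(z <- level n j.+1 | (0 < z i)%N) G z =
  \sum_(y <- level n j) G (y + U_(i))%MM.
Proof.
rewrite -big_filter -(big_map (fun y => y + U_(i))%MM predT G) /=.
apply: perm_big; apply: uniq_perm.
- exact/filter_uniq/level_uniq.
- by rewrite map_inj_uniq ?level_uniq // => x y /addIm.
move=> z; rewrite mem_filter mem_level; apply/idP/mapP => [/andP[zi dz]|[y]].
  have le_iz : (U_(i) <= z)%MM by rewrite lep1mP -lt0n.
  exists (z - U_(i))%MM; last by rewrite submK.
  by rewrite mem_level -eqSS -(eqP dz) -{2}(submK le_iz) mdegD mdeg1 addn1.
rewrite mem_level => /eqP dy ->.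
by rewrite mnmDE mnm1E eqxx addn1 mdegD mdeg1 dy addn1 /=.
Qed.

(* Vanishes outside the box [{0..m}^n]; it makes [raise] and [lower] adjoint. *)
Definition box_weight (K : realDomainType) n m (z : 'X_{1..n}) : K :=
  (\prod_(i < n) 'C(m, z i))%:R.

(** Together with [lower], this is the sl2-action on the [n]-th tensor power of the irreducible
    representation of dimension [m + 1], seen on functions on the box [{0..m}^n]. At [z i = 0] the
    truncated [z - U_(i)] is harmless, its coefficient being 0. *)
Definition raise (K : realDomainType) n (v : 'X_{1..n} -> K)
    (z : 'X_{1..n}) : K :=
  \sum_(i < n) (z i)%:R * v (z - U_(i))%MM.

Definition lower (K : realDomainType) n m (v : 'X_{1..n} -> K)
    (z : 'X_{1..n}) : K :=
  \sum_(i < n) (m%:R - (z i)%:R) * v (z + U_(i))%MM.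

Lemma box_weight_shift (K : realDomainType) n m (i : 'I_n) (y : 'X_{1..n}) :
  (y i).+1%:R * box_weight K m (y + U_(i))%MM =
  (m%:R - (y i)%:R) * box_weight K m y.
Proof.
rewrite /box_weight [in LHS](bigD1 i) //= [in RHS](bigD1 i) //=.
rewrite (eq_bigr (fun k => 'C(m, y k))) => [|k ki]; last first.
  by rewrite mnmDE mnm1E eq_sym (negbTE ki) addn0.
rewrite mnmDE mnm1E eqxx addn1 !natrM !mulrA; congr (_ * _).
rewrite -natrM mul_bin_left natrM.
have [le_ym|lt_my] := leqP (y i) m; first by rewrite natrB.
by rewrite bin_small // !mulr0.
Qed.

Lemma box_weight_ge0 (K : realDomainType) n m (z : 'X_{1..n}) :
  0 <= box_weight K m z.
Proof. exact: ler0n. Qed.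

Lemma box_weight_gt0 (K : realDomainType) n m (z : 'X_{1..n}) :
  (forall i, z i <= m)%N -> 0 < box_weight K m z.
Proof. by move=> le_zm; rewrite ltr0n prodn_gt0 // => i; rewrite bin_gt0. Qed.

Lemma raise_lower_adjoint (K : realDomainType) n m j (u v : 'X_{1..n} -> K) :
  \sum_(z <- level n j.+1) box_weight K m z * (raise v z * u z) =
  \sum_(y <- level n j) box_weight K m y * (v y * lower m u y).
Proof.
under eq_bigr do rewrite mulr_suml mulr_sumr.
under [RHS]eq_bigr do rewrite !mulr_sumr.
rewrite exchange_big [RHS]exchange_big /=; apply: eq_bigr => i _.
rewrite (bigID (fun z : 'X_{1..n} => 0 < z i)%N) /= [X in _ + X]big1 ?addr0.
  rewrite big_level_shift; apply: eq_bigr => y _.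
  rewrite addmK mnmDE mnm1E eqxx addn1.
  transitivity ((y i).+1%:R * box_weight K m (y + U_(i))%MM *
                (v y * u (y + U_(i))%MM)); first by ring.
  by rewrite box_weight_shift; ring.
by move=> z; rewrite -leqNgt leqn0 => /eqP ->; rewrite !mul0r mulr0.
Qed.

(** The sl2 commutator relation. Terms with distinct indices cancel, and the diagonal ones leave [(m
    - y i)(y i + 1) - y i (m - y i + 1) = m - 2 y i]. *)
Lemma lower_raise (K : realDomainType) n m (v : 'X_{1..n} -> K) y :
  lower m (raise v) y =
  raise (lower m v) y + ((n * m)%:R - 2 * (mdeg y)%:R) * v y.
Proof.
have -> : (n * m)%:R - 2 * (mdeg y)%:R =
    \sum_(i < n) (m%:R - 2 * (y i)%:R) :> K.
  by rewrite sumrB sumr_const card_ord -[_ *+ n]mulr_natl natrM -mulr_sumr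
             mdegE natr_sum.
under [LHS]eq_bigr do rewrite mulr_sumr.
rewrite exchange_big mulr_suml -big_split /=; apply: eq_bigr => k _.
rewrite mulr_sumr (bigD1 k) // [in RHS](bigD1 k) //= addrAC.
rewrite addrC [RHS]addrC; congr (_ + _).
  apply: eq_bigr => i ik; rewrite !mnmE (negbTE ik) eq_sym (negbTE ik).
  rewrite addn0 subn0; case Ey: (y k) => [|t]; first by rewrite !mul0r mulr0.
  by rewrite [(_ - _ + _)%MM]addmC addmBA ?lep1mP ?Ey // [(U_(i) + y)%MM]addmC; ring.
rewrite addmK !mnmE eqxx; case Ey: (y k) => [|t] /=; first by ring.
by rewrite submK ?lep1mP ?Ey // addn1 subn1 /= -!natr1; ring.
Qed.

(* One step of the hard Lefschetz property: in the weighted inner product the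
   norm of [raise v] is at least [n * m - 2 * j] times the norm of [v]. *)
Lemma raise_inj (K : realDomainType) n m j (v : 'X_{1..n} -> K) :
  (j.*2 < n * m)%N ->
  (forall z : 'X_{1..n}, (forall i, z i <= m)%N -> mdeg z = j.+1 ->
     raise v z = 0) ->
  forall z : 'X_{1..n}, (forall i, z i <= m)%N -> mdeg z = j -> v z = 0.
Proof.
move=> lt_j v0 z le_zm dz.
pose N j (u : 'X_{1..n} -> K) := \sum_(y <- level n j) box_weight K m y * u y ^+ 2.
have Npos k u : 0 <= N k u.
  by apply: sumr_ge0 => y _; rewrite mulr_ge0 ?box_weight_ge0 ?sqr_ge0.
have N0 : N j.+1 (raise v) = 0.
  rewrite /N big_seq big1 // => y; rewrite mem_level => /eqP dy.
  have [/forallP le_ym|] := boolP [forall i, y i <= m]%N.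
    by rewrite v0 // expr0n mulr0.
  rewrite negb_forall => /existsP[i]; rewrite -ltnNge => lt_my.
  by rewrite /box_weight (bigD1 i) //= bin_small // mul0n mul0r.
have : N j v = 0.
  have cpos : 0 < (n * m)%:R - 2 * j%:R :> K.
    by rewrite subr_gt0 -natrM ltr_nat mul2n.
  (* It suffices that [(n * m - 2 * j) * N j v <= N j.+1 (raise v)]. By adjointness and the
     commutator, the difference pairs [raise (lower m v)] with [v]. *)
  apply/eqP; rewrite eq_le Npos andbT -(pmulr_rle0 _ cpos) -N0 /N.
  under [X in _ <= X]eq_bigr do rewrite expr2.
  rewrite raise_lower_adjoint mulr_sumr -subr_ge0 -sumrB.
  under eq_big_seq => y.
    rewrite mem_level => /eqP dy; rewrite lower_raise dy.
    rewrite (_ : _ - _ = box_weight K m y * (raise (lower m v) y * v y)); last by ring.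
    over.
  case: j {lt_j v0 dz N0 cpos} => [|j].
    rewrite big_seq big1 // => y; rewrite mem_level mdeg_eq0 => /eqP ->.
    by rewrite /raise big1 ?mul0r ?mulr0 // => i _; rewrite mnm0E mul0r.
  (* A second use of adjointness gives the squared norm of [lower m v], one level down. *)
  rewrite raise_lower_adjoint.
  by apply: sumr_ge0 => y _; rewrite mulr_ge0 ?box_weight_ge0 // -expr2 sqr_ge0.
move/eqP; rewrite psumr_eq0 => [/allP/(_ z)|y _]; last first.
  by rewrite mulr_ge0 ?box_weight_ge0 ?sqr_ge0.
rewrite mem_level dz eqxx => /(_ isT) /=.
by rewrite mulf_eq0 gt_eqF ?box_weight_gt0 //= sqrf_eq0 => /eqP.
Qed.

(** * Coefficients and homogeneous components of polynomials *)

Lemma mcoeff_mulXU (R : nzRingType) n (p : {mpoly R[n]}) i a :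
  (p * 'X_i)@_a = if (0 < a i)%N then p@_(a - U_(i))%MM else 0.
Proof.
case: ifP => [ai|/negbT ai].
  have le_ia : (U_(i) <= a)%MM by rewrite lep1mP -lt0n.
  by rewrite -{1}(submK le_ia) addmC mcoeffMX.
apply/eqP; rewrite mcoeff_eq0 (perm_mem (msuppMX _ _)).
apply/mapP => -[b _ eq_a]; move: ai.
by rewrite eq_a mnmDE mnm1E eqxx.
Qed.

Lemma msize_leq (R : nzRingType) n (p : {mpoly R[n]}) d :
  (forall a, (d <= mdeg a)%N -> p@_a = 0) -> (msize p <= d)%N.
Proof.
move=> p0; rewrite msizeE; apply/bigmax_leqP_seq => a; rewrite mcoeff_msupp => pa _.
by rewrite ltnNge; apply: contra pa => /p0 ->.
Qed.

Lemma mcoeff_sum_level (R : nzRingType) n d (c : 'X_{1..n} -> R) a :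
  (\sum_(b <- level n d) c b *: 'X_[b])@_a = if mdeg a == d then c a else 0.
Proof.
rewrite raddf_sum /=; under eq_bigr do rewrite mcoeffZ mcoeffX.
have [da|da] := boolP (mdeg a == d); last first.
  rewrite big_seq big1 // => b; rewrite mem_level => db.
  by case: (b =P a) da => [<-|_ _]; rewrite ?db ?mulr0.
rewrite (bigD1_seq a) ?level_uniq ?mem_level //= eqxx mulr1 big1 ?addr0 // => b.
by move=> /negbTE ->; rewrite mulr0.
Qed.

Lemma pihomog_levelE (R : nzRingType) n d (p : {mpoly R[n]}) :
  pihomog mdeg d p = \sum_(b <- level n d) p@_b *: 'X_[b].
Proof.
rewrite pihomogE -big_filter [RHS](bigID (mem (msupp p))) /=.
rewrite [X in _ + X]big1 ?addr0 => [|b]; last first.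
  by rewrite -mcoeff_eq0 => /eqP ->; rewrite scale0r.
rewrite -[RHS]big_filter; apply: perm_big; apply: uniq_perm.
- by rewrite filter_uniq.
- by rewrite filter_uniq ?level_uniq.
by move=> b; rewrite !mem_filter mem_level andbC.
Qed.

(** * Falling factorials and their combinations *)

Definition ffall n (a : 'X_{1..n}) : {mpoly rat[n]} :=
  \prod_(i < n) \prod_(k < a i) ('X_i - k%:R).

Lemma ffall0 n : ffall (0%MM : 'X_{1..n}) = 1.
Proof. by rewrite /ffall big1 // => i _; rewrite mnm0E big_ord0. Qed.

Lemma ffallS n (b : 'X_{1..n}) i :
  ffall (b + U_(i))%MM = ffall b * ('X_i - (b i)%:R).
Proof.
rewrite /ffall (bigD1 i) //= [in RHS](bigD1 i) //=.
rewrite mnmDE mnm1E eqxx addn1 big_ord_recr /= mulrAC; congr (_ * _ * _).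
apply: eq_bigr => k ki.
by rewrite mnmDE mnm1E eq_sym (negbTE ki) addn0.
Qed.

Definition nat_point n (z : 'X_{1..n}) : 'I_n -> rat := fun i => (z i)%:R.

Lemma meval_ffall n (a z : 'X_{1..n}) :
  (ffall a).@[nat_point z] = (\prod_(i < n) (z i) ^_ (a i))%:R.
Proof.
rewrite /ffall rmorph_prod natr_prod; apply: eq_bigr => i _.
rewrite rmorph_prod /=; elim: (a i) => [|k IHk]; first by rewrite big_ord0.
rewrite big_ord_recr /= IHk mevalB mevalXU rmorph_nat ffactnSr natrM.
have [le_kz|lt_zk] := leqP k (z i); first by rewrite natrB.
by rewrite ffact_small // !mul0r.
Qed.

(** A nonzero value at [z] forces [a <= z] in every coordinate, and then the degrees force
    [z = a]. *)
Lemma meval_ffall_eq0 n (a z : 'X_{1..n}) :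
  (mdeg z <= mdeg a)%N -> z != a -> (ffall a).@[nat_point z] = 0.
Proof.
move=> le_za ne_za; rewrite meval_ffall.
have [/existsP[i lt_i]|] := boolP [exists i, z i < a i]%N.
  by rewrite (bigD1 i) //= ffact_small.
rewrite negb_exists => /forallP ge_za; case/negP: ne_za.
have le_az : (a <= z)%MM by apply/mnm_lepP => i; rewrite leqNgt.
have: mdeg (z - a)%MM == 0%N.
  by rewrite -(eqn_add2r (mdeg a)) -mdegD submK // eqn_leq le_za -{1}(submK le_az)
             mdegD leq_addl.
by rewrite mdeg_eq0 -{2}(submK le_az) => /eqP ->; rewrite add0m.
Qed.

Lemma mnm_ind_deg n (P : 'X_{1..n} -> Prop) :
  P 0%MM -> (forall b i, P b -> P (b + U_(i))%MM) -> forall a, P a.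
Proof.
move=> P0 PS a; have [d] := ubnP (mdeg a).
elim: d a => // d IHd a; rewrite ltnS => le_ad.
have [->//|] := eqVneq a 0%MM; rewrite -mdeg_eq0 mdegE sum_nat_eq0 negb_forall.
case/existsP => i /= ai; have le_ia : (U_(i) <= a)%MM by rewrite lep1mP.
rewrite -(submK le_ia); apply/PS/IHd.
by move: le_ad; rewrite -{1}(submK le_ia) mdegD mdeg1 addn1.
Qed.

Lemma msizeM_leq (R : idomainType) n (p q : {mpoly R[n]}) :
  (msize (p * q)%R <= (msize p + msize q).-1)%N.
Proof.
have [->|p0] := eqVneq p 0; first by rewrite mul0r msize0.
have [->|q0] := eqVneq q 0; first by rewrite mulr0 msize0.
by rewrite msizeM.
Qed.

(** By [ffallS] the difference for [b + U_(i)] is ['X_i] times the one for [b], minus [b i] times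
    [ffall b]; both have degree at most [mdeg b]. *)
Lemma msize_ffallB n (a : 'X_{1..n}) : (msize (ffall a - 'X_[a])%R <= mdeg a)%N.
Proof.
elim/mnm_ind_deg: a => [|b i IHb]; first by rewrite ffall0 mpolyX0 subrr msize0.
have sz_b : (msize (ffall b) <= (mdeg b).+1)%N.
  rewrite -[ffall b](subrK 'X_[b]) (leq_trans (msizeD_le _ _)) // geq_max.
  by rewrite msizeX leqnn leqW.
rewrite ffallS mpolyXD mdegD mdeg1 addn1.
rewrite (_ : _ - _ = (ffall b - 'X_[b]) * 'X_i - (b i)%:R *: ffall b).
  rewrite (leq_trans (msizeD_le _ _)) // geq_max msizeN.
  rewrite (leq_trans (msizeZ_le _ _)) // andbT.
  by rewrite (leq_trans (msizeM_leq _ _)) // msizeX mdeg1 addn2.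
by rewrite scaler_nat -mulr_natr; ring.
Qed.

(** Terms of [h] in degrees other than [d] are ignored, so [h] need not be homogeneous. *)
Definition ffall_comb n d (h : {mpoly rat[n]}) : {mpoly rat[n]} :=
  \sum_(a <- level n d) h@_a *: ffall a.

Lemma msize_ffall_comb n d (g : {mpoly rat[n]}) :
  (msize g <= d.+1)%N -> (msize (g - ffall_comb d g)%R <= d)%N.
Proof.
move=> sz_g; pose t := \sum_(a <- level n d) g@_a *: ('X_[a] - ffall a).
rewrite (_ : _ - _ = g - pihomog mdeg d g + t).
  rewrite (leq_trans (msizeD_le _ _)) // geq_max; apply/andP; split.
    apply: msize_leq => a le_da; rewrite mcoeffB pihomog_levelE mcoeff_sum_level.
    have [//|lt_da] := eqVneq (mdeg a) d; first by rewrite subrr.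
    apply/eqP; rewrite subr0 mcoeff_eq0 msize_mdeg_ge //.
    by rewrite (leq_trans sz_g) // ltn_neqAle eq_sym lt_da.
  rewrite (leq_trans (msize_sum _ _ _)) //; apply/bigmax_leqP_seq => a.
  rewrite mem_level => /eqP <- _; rewrite (leq_trans (msizeZ_le _ _)) //.
  by rewrite -msizeN opprB msize_ffallB.
rewrite /t (eq_bigr (fun a => g@_a *: 'X_[a] - g@_a *: ffall a)) => [|a _].
  by rewrite sumrB -pihomog_levelE addrA subrK.
by rewrite scalerBr.
Qed.

(** Summing [ffallS] over [i] produces the factor [\sum_i ('X_i - b i)], and the [b i] add up to
    [d]. *)
Lemma ffall_comb_sumX n d (h : {mpoly rat[n]}) :
  ffall_comb d.+1 ((\sum_(i < n) 'X_i) * h) =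
  ffall_comb d h * (\sum_(i < n) 'X_i - d%:R).
Proof.
rewrite /ffall_comb mulrC mulr_sumr mulr_suml.
under eq_bigr => a _.
  rewrite raddf_sum /= scaler_suml.
  under eq_bigr do rewrite mcoeff_mulXU.
  over.
rewrite exchange_big /=.
transitivity (\sum_(i < n) \sum_(b <- level n d) h@_b *: ffall (b + U_(i))%MM).
  apply: eq_bigr => i _; rewrite (bigID (fun z : 'X_{1..n} => 0 < z i)%N) /=.
  rewrite [X in _ + X]big1 => [|a /negbTE ->]; last by rewrite scale0r.
  rewrite addr0 big_level_shift; apply: eq_bigr => b _.
  by rewrite mnmDE mnm1E eqxx addn1 addmK.
rewrite exchange_big /=; apply: eq_big_seq => b; rewrite mem_level => /eqP <-.
rewrite -scaler_sumr -scalerAl; congr (_ *: _).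
under [LHS]eq_bigr do rewrite ffallS.
by rewrite -mulr_sumr sumrB mdegE natr_sum.
Qed.

Lemma ffall_comb_pihomog n d (g : {mpoly rat[n]}) :
  ffall_comb d (pihomog mdeg d g) = ffall_comb d g.
Proof.
apply: eq_big_seq => a; rewrite mem_level => da.
by rewrite pihomog_levelE mcoeff_sum_level da.
Qed.

Lemma ffall_combD n d : {morph @ffall_comb n d : p q / p + q}.
Proof.
move=> p q; rewrite /ffall_comb -big_split; apply: eq_bigr => a _ /=.
by rewrite mcoeffD scalerDl.
Qed.

Lemma ffall_combZ n d c (p : {mpoly rat[n]}) :
  ffall_comb d (c *: p) = c *: ffall_comb d p.
Proof.
by rewrite /ffall_comb scaler_sumr; apply: eq_bigr => a _; rewrite mcoeffZ scalerA.
Qed.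

Lemma dhomog_sumX n : \sum_(i < n) 'X_i \is [in rat[n], 1.-homog].
Proof. by apply: rpred_sum => i _; rewrite dhomogX; apply/eqP/mdeg1. Qed.

Lemma meval_sumX n (z : 'X_{1..n}) :
  (\sum_(i < n) 'X_i).@[nat_point z] = (mdeg z)%:R.
Proof.
by rewrite raddf_sum mdegE natr_sum; apply: eq_bigr => i _; rewrite /= mevalXU.
Qed.

(* On the level [mdeg z = l] the linear form [\sum_i 'X_i - d] is the nonzero
   constant [l - d], so a combination of falling factorials of degree [d < l]
   is also one of degree [d + 1], the coefficients being multiplied by the
   linear form [\sum_i 'X_i]. *)
Lemma ffall_comb_represents n l d (g : {mpoly rat[n]}) :
  (d <= l)%N -> (msize g <= d.+1)%N ->
  exists h q : {mpoly rat[n]},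
    [/\ h \is d.-homog, h = pihomog mdeg d g + (\sum_(i < n) 'X_i) * q
      & forall z : 'X_{1..n}, mdeg z = l ->
          (ffall_comb d h).@[nat_point z] = g.@[nat_point z]].
Proof.
elim: d g => [|d IHd] g le_dl sz_g.
  exists (pihomog mdeg 0 g), 0; rewrite mulr0 addr0; split; rewrite ?pihomogP //.
  move=> z _; rewrite ffall_comb_pihomog; congr meval.
  apply/esym/eqP; rewrite -subr_eq0 -msize_poly_eq0 -leqn0.
  exact: msize_ffall_comb.
(* The remainder [g - ffall_comb d.+1 g] has degree at most [d], so induction applies to it. The
   scalar [c] inverts the value of [\sum_i 'X_i - d] on level [l], nonzero since [d < l]. *)
have [h [q [hom_h _ hE]]] := IHd _ (ltnW le_dl) (msize_ffall_comb sz_g).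
pose c : rat := (l%:R - d%:R)^-1.
exists (pihomog mdeg d.+1 g + (\sum_(i < n) 'X_i) * (c *: h)), (c *: h); split=> //.
  rewrite rpredD ?pihomogP // -[d.+1]add1n dhomogM ?dhomog_sumX //.
  exact: rpredZ.
move=> z dz; rewrite ffall_combD ffall_comb_pihomog mevalD -scalerAr ffall_combZ.
rewrite ffall_comb_sumX mevalZ mevalM mevalB meval_sumX hE // dz rmorph_nat mevalB.
have cne0 : l%:R - d%:R != 0 :> rat.
  by rewrite subr_eq0 eqr_nat gtn_eqF.
by rewrite mulrCA mulVf // mulr1 addrC subrK.
Qed.

(** Coordinatewise, [z i * (z i - 1) ^_ (a i) = (z i - a i) * z i ^_ (a i)], both sides being 0 when
    [z i < a i]. *)
Lemma raise_ffall_comb n d (h : {mpoly rat[n]}) (z : 'X_{1..n}) :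
  raise (fun y => (ffall_comb d h).@[nat_point y]) z =
  ((mdeg z)%:R - d%:R) * (ffall_comb d h).@[nat_point z].
Proof.
rewrite /raise /ffall_comb.
under eq_bigr do rewrite raddf_sum mulr_sumr.
rewrite exchange_big (raddf_sum (meval (nat_point z))) mulr_sumr.
apply: eq_big_seq => a.
rewrite mem_level => /eqP <- /=.
under eq_bigr do rewrite mevalZ mulrCA.
rewrite -mulr_sumr mevalZ mulrCA; congr (_ * _).
rewrite !mdegE !natr_sum -sumrB mulr_suml; apply: eq_bigr => i _.
rewrite !meval_ffall (bigD1 i) //= [in RHS](bigD1 i) //= !natrM !mulrA.
congr (_ * _%:R); last first.
  by apply: eq_bigr => k ki; rewrite mnmBE mnm1E eq_sym (negbTE ki) subn0.
rewrite mnmBE mnm1E eqxx subn1.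
have [le_az|lt_za] := leqP (a i) (z i).
  by rewrite -natrB // -!natrM -ffactnS ffactnSr mulnC.
by rewrite [in RHS]ffact_small // mulr0 -natrM -ffactnS ffact_small // ltnW.
Qed.

(** Vanishing descends one level at a time from [l] to [d] by [raise_inj]. On level [d] the value at
    [a] is [h@_a] times a product of factorials. *)
Lemma ffall_comb_inj n m l d (h : {mpoly rat[n]}) :
  (d <= l)%N -> (l.*2 <= n * m)%N ->
  (forall z : 'X_{1..n}, (forall i, z i <= m)%N -> mdeg z = l ->
     (ffall_comb d h).@[nat_point z] = 0) ->
  forall a : 'X_{1..n}, (forall i, a i <= m)%N -> mdeg a = d -> h@_a = 0.
Proof.
move=> le_dl; rewrite -(subnKC le_dl); move: (l - d)%N => k {l le_dl}.
elim: k => [|k IHk]; rewrite ?addn0 ?addnS => le_l h0 a le_am da; last first.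
  apply: IHk le_am da; first by rewrite (leq_trans _ le_l) // leq_double.
  apply: raise_inj => [|z le_zm dz]; first by rewrite (leq_trans _ le_l) // ltn_double.
  by rewrite raise_ffall_comb h0 // mulr0.
have := h0 a le_am da; rewrite raddf_sum (bigD1_seq a) ?level_uniq ?mem_level ?da //=.
rewrite big_seq_cond big1 => [|b /andP[]]; last first.
  rewrite mem_level => /eqP db ne_ba.
  by rewrite mevalZ meval_ffall_eq0 ?mulr0 ?da ?db // eq_sym.
rewrite addr0 mevalZ meval_ffall => /eqP; rewrite mulf_eq0 pnatr_eq0.
have /negbTE -> : (\prod_(i < n) a i ^_ a i != 0)%N.
  by rewrite -lt0n prodn_gt0 // => i; rewrite ffactnn fact_gt0.
by rewrite orbF => /eqP.
Qed.

(** * Top components, vanishing on the slice, and generated ideals *)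

Lemma top_compD n d (h r : {mpoly rat[n]}) :
  h != 0 -> h \is d.-homog -> (msize r <= d)%N ->
  h + r <> 0 /\ top_comp (h + r) = h.
Proof.
move=> h0 hom_h sz_r.
have [a ah] : exists a, a \in msupp h.
  move: h0; rewrite -msupp_eq0; case: (msupp h) => // a s _.
  by exists a; rewrite mem_head.
have da := dhomog_mf hom_h ah.
have ahr : a \in msupp (h + r).
  rewrite mcoeff_msupp mcoeffD (_ : r@_a = 0) ?addr0 -?mcoeff_msupp //.
  by apply/eqP; rewrite mcoeff_eq0 msize_mdeg_ge // da.
split=> [hr0|]; first by rewrite hr0 mcoeff_msupp mcoeff0 eqxx in ahr.
rewrite /top_comp; have -> : msize (h + r) = d.+1.
  apply/eqP; rewrite eqn_leq -{2}da msize_mdeg_lt // andbT.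
  rewrite (leq_trans (msizeD_le _ _)) // geq_max (leqW sz_r) andbT.
  by rewrite msizeE; apply/bigmax_leqP_seq => b /(dhomog_mf hom_h) ->.
rewrite pihomogD pihomog_dE // pihomogE big_seq_cond big1 ?addr0 // => b.
by case/andP=> /msize_mdeg_lt lt_b /eqP db; rewrite db ltnNge sz_r in lt_b.
Qed.

Lemma map_ratr_meval (R : realType) n (f : {mpoly rat[n]}) (u : 'I_n -> rat) :
  (map_mpoly (ratr : rat -> R) f).@[fun i => ratr (u i)] = ratr f.@[u].
Proof.
rewrite !mevalE (perm_big _ (msupp_map_mpoly f (fmorph_inj _))) rmorph_sum.
apply: eq_bigr => a _; rewrite mcoeff_map_mpoly rmorphM rmorph_prod.
by congr (_ * _); apply: eq_bigr => i _; rewrite rmorphXn.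
Qed.

(** Slice points have natural coordinates, and evaluation at rational points commutes with the
    injective embedding [ratr]; the problem thus descends from [R] to the rationals. *)
Lemma vanishing_sliceP (R : realType) l m n (f : {mpoly rat[n]}) :
  vanishing_ideal (@slice R l m n) f <->
  (forall z : 'X_{1..n}, (forall i, z i <= m)%N -> mdeg z = l ->
     f.@[nat_point z] = 0).
Proof.
split=> [f0 z le_zm dz|f0 z [a [le_a sum_a za]]].
  suff /eqP : ratr f.@[nat_point z] = 0 :> R by rewrite fmorph_eq0 => /eqP.
  rewrite -map_ratr_meval; apply: f0; exists (fun i => (z i)%:Z); split=> [i||i].
  - by rewrite /= lez_nat le_zm.
  - by rewrite -dz mdegE -natz natr_sum; apply: eq_bigr => i _; rewrite natz.
  - by rewrite /nat_point ratr_nat.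
pose y := [multinom `|a i|%N | i < n].
have ay i : a i = y i by rewrite mnmE gez0_abs //; case/andP: (le_a i).
rewrite (meval_eq (v2 := fun i => ratr (nat_point y i))) => [|i].
  rewrite map_ratr_meval f0 ?rmorph0 // => [i|].
    by rewrite -lez_nat -ay; case/andP: (le_a i).
  apply/eqP; rewrite -eqz_nat -sum_a mdegE -natz natr_sum.
  by apply/eqP/eq_bigr => i _; rewrite ay natz.
by rewrite za ay /nat_point ratr_nat.
Qed.

Lemma ideal_gen_mem (S : comNzRingType) (G : S -> Prop) g : G g -> ideal_gen G g.
Proof.
move=> Gg; exists [:: (1, g)]; last by rewrite big_seq1 mul1r.
by move=> hg; rewrite inE => /eqP ->.
Qed.

Lemma ideal_gen0 (S : comNzRingType) (G : S -> Prop) : ideal_gen G 0.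
Proof. by exists [::]; rewrite ?big_nil. Qed.

Lemma ideal_genD (S : comNzRingType) (G : S -> Prop) f g :
  ideal_gen G f -> ideal_gen G g -> ideal_gen G (f + g).
Proof.
move=> [s Gs ->] [t Gt ->]; exists (s ++ t); last by rewrite big_cat.
by move=> hg; rewrite mem_cat => /orP[/Gs|/Gt].
Qed.

Lemma ideal_genM (S : comNzRingType) (G : S -> Prop) f g :
  ideal_gen G f -> ideal_gen G (g * f).
Proof.
move=> [s Gs ->]; exists [seq (g * hg.1, hg.2) | hg <- s].
  by move=> _ /mapP[hg /Gs Ghg ->].
by rewrite big_map mulr_sumr; apply: eq_bigr => hg _; rewrite mulrA.
Qed.

Lemma ideal_gen_sum (S : comNzRingType) (G : S -> Prop) (I : eqType) (r : seq I) F :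
  (forall i, i \in r -> ideal_gen G (F i)) -> ideal_gen G (\sum_(i <- r) F i).
Proof.
move=> GF; rewrite big_seq; elim/big_ind: _ => //; first exact: ideal_gen0.
exact: ideal_genD.
Qed.

Lemma ideal_gen_sub (S : comNzRingType) (G H : S -> Prop) :
  (forall g, G g -> ideal_gen H g) -> forall f, ideal_gen G f -> ideal_gen H f.
Proof.
move=> GH f [s Gs ->]; apply: ideal_gen_sum => hg /Gs /GH.
exact: ideal_genM.
Qed.

(** * The two inclusions between the ideals *)

Lemma top_comp_ffall n (a : 'X_{1..n}) :
  ffall a <> 0 /\ top_comp (ffall a) = 'X_[a].
Proof.
rewrite -[ffall a](subrK 'X_[a]) addrC.
apply: (@top_compD n (mdeg a)); rewrite ?dhomogX ?msize_ffallB //.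
by rewrite -msupp_eq0 msuppX.
Qed.

Lemma slice_gens_sub (R : realType) l m n (g : {mpoly rat[n]}) :
  (0 < n)%N -> slice_gens l m g -> gr_ideal (@slice R l m n) g.
Proof.
move=> n_gt0 [i||a da]; apply: ideal_gen_mem.
(* Every [z i <= m] is a root of the falling factorial of length [m + 1] in ['X_i]. *)
- rewrite mpolyXn; exists (ffall (U_(i) *+ m.+1)%MM).
  have [nz <-] := top_comp_ffall (U_(i) *+ m.+1)%MM; split=> //.
  apply/vanishing_sliceP => z le_zm _; rewrite meval_ffall (bigD1 i) //=.
  by rewrite mulmnE mnm1E eqxx mul1n ffact_small ?ltnS.
- have [] := @top_compD n 1 (\sum_(i < n) 'X_i) (- l%:R) _ (dhomog_sumX n).
  (* The linear form is nonzero because [n > 0] provides a variable. *)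
  + pose i0 := Ordinal n_gt0; apply/eqP => /(congr1 (mcoeff U_(i0))) /eqP.
    rewrite mcoeff0 raddf_sum (bigD1 i0) //= mcoeffXU eqxx big1 ?addr0 // => i.
    by rewrite mcoeffXU => /negbTE ->.
  + by rewrite msizeN -mpolyC_nat msizeC; case: (_ != 0).
  move=> nz top; exists (\sum_(i < n) 'X_i - l%:R); split=> //.
  apply/vanishing_sliceP => z _ dz.
  by rewrite mevalB meval_sumX dz rmorph_nat subrr.
- exists (ffall a); have [nz <-] := top_comp_ffall a; split=> //.
  apply/vanishing_sliceP => z _ dz; apply: meval_ffall_eq0; rewrite ?dz ?da //.
  by apply/eqP => za; move: dz; rewrite za da => /eqP; rewrite eqn_leq ltnn.
Qed.

(** Removing variables one by one from a monomial of degree above [l] reaches degree exactly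
    [l + 1]; an exponent above [m] exhibits a factor ['X_i ^+ m.+1]. *)
Lemma mpolyX_slice_gens l m n (a : 'X_{1..n}) :
  (l < mdeg a)%N || [exists i, m < a i]%N -> ideal_gen (@slice_gens l m n) 'X_[a].
Proof.
case/orP => [|/existsP[i lt_mi]]; last first.
  have le_ia : (U_(i) *+ m.+1 <= a)%MM.
    apply/mnm_lepP => k; rewrite mulmnE mnm1E.
    by case: eqP => [<-|]; rewrite ?mul1n.
  rewrite -(submK le_ia) mpolyXD -mpolyXn; apply: ideal_genM.
  exact/ideal_gen_mem/GenPower.
elim/mnm_ind_deg: a => [|b i IHb]; first by rewrite mdeg0.
rewrite mdegD mdeg1 addn1 ltnS leq_eqVlt => /orP[/eqP db|/IHb]; last first.
  by rewrite mpolyXD mulrC; apply: ideal_genM.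
by apply/ideal_gen_mem/GenMonomial; rewrite mdegD mdeg1 addn1 db.
Qed.

Lemma top_comp_slice_gens (R : realType) l m n (f : {mpoly rat[n]}) :
  (l.*2 <= n * m)%N -> f <> 0 -> vanishing_ideal (@slice R l m n) f ->
  ideal_gen (@slice_gens l m n) (top_comp f).
Proof.
move=> le_l nz_f /vanishing_sliceP f0; rewrite /top_comp.
have sz_f : (msize f <= (msize f).-1.+1)%N by rewrite leqSpred.
move: (msize f).-1 sz_f => d sz_f.
have [lt_ld|le_dl] := ltnP l d.
  rewrite pihomog_levelE; apply: ideal_gen_sum => a; rewrite mem_level => /eqP da.
  rewrite -mul_mpolyC; apply/ideal_genM/mpolyX_slice_gens.
  by rewrite da lt_ld.
have [h [q [hom_h hE hf]]] := ffall_comb_represents le_dl sz_f.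
have h0 := @ffall_comb_inj n m l d h le_dl le_l.
rewrite (_ : pihomog _ _ _ = h + (- q) * \sum_(i < n) 'X_i); last first.
  by rewrite hE; ring.
apply: ideal_genD; last exact/ideal_genM/ideal_gen_mem/GenSum.
rewrite -(pihomog_dE hom_h) pihomog_levelE.
apply: ideal_gen_sum => a; rewrite mem_level => /eqP da; rewrite -mul_mpolyC.
(* Monomials outside the box are multiples of some ['X_i ^+ m.+1]; the coefficients of [h] inside
   the box vanish. *)
have [ex_i|] := boolP [exists i, m < a i]%N.
  by apply/ideal_genM/mpolyX_slice_gens; rewrite ex_i orbT.
rewrite negb_exists => /forallP le_am; rewrite h0 //.
- by rewrite mpolyC0 mul0r; apply: ideal_gen0.
- by move=> z le_zm dz; rewrite hf ?f0.
- by move=> i; rewrite leqNgt.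
Qed.

Local Close Scope ring_scope.

Theorem theoremC (R : realType) (n m l : nat)
    (hn : 1 <= n) (hm : 1 <= m) (hl0 : 0 < l) (hl : l <= (n * m) %/ 2) :
  same_set (gr_ideal (@slice R l m n)) (ideal_gen (@slice_gens l m n)).
Proof.
move=> f; split; apply: ideal_gen_sub => g.
  move=> [p [nz_p p0 ->]]; apply: top_comp_slice_gens nz_p p0.
  by rewrite -muln2 -leq_divRL.
exact: slice_gens_sub.
Qed.
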